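(* Let $X$ be a linear space, let $F:X\rightrightarrows\overline{Y}$ and $G:X\rightrightarrows U$ be set-valued maps, and let $c\in\operatorname{int}C$ be fixed. If $F$ is $C$-convex, $G$ is $D$-convex, $$G(\operatorname{dom}F)\cap(-\operatorname{int}D)\neq\emptyset,$$ and $W(0)\neq\{-\infty\}$, then problem (P) is stable.
   Context: Spaces and cones. All linear spaces are real. $Y$ is a partially ordered linear topological space whose order is induced by a convex cone $C$ with $\emptyset\neq\operatorname{int}C\neq Y$. $\overline{Y}=Y\cup\{-\infty\}\cup\{+\infty\}$ with $-\infty\le y\le+\infty$ for all $y\in Y$. $U$ is a separated locally convex space with topological dual $U^*$, and $\langle u^*,u\rangle$ denotes the pairing of the dual pair $\langle U,U^*\rangle$. $D\subseteq U$ is a proper closed convex cone with nonempty interior, and $D^\circ=\{u^*\in U^* : \langle u^*,d\rangle\le 0\ \forall d\in D\}$ is its negative polar cone. A vector $c\in\operatorname{int}C$ is fixed. Sums of subsets of $\overline{Y}$ are elementwise (Minkowski) sums, with $A+\emptyset=\emptyset$, $y+(\pm\infty)=\pm\infty$ for $y\in Y$, $(+\infty)+(-\infty)=+\infty$, and $\alpha\cdot(\pm\infty)=\pm\infty$ for $\alpha>0$. Infimal sets. For $A\subseteq\overline{Y}$, the upper closure is $\operatorname{Cl}_+A=Y$ if $-\infty\in A$; $\operatorname{Cl}_+A=\emptyset$ if $A=\{+\infty\}$; and otherwise $\operatorname{Cl}_+A=\{y\in Y : \{y\}+\operatorname{int}C\subseteq (A\setminus\{+\infty\})+\operatorname{int}C\}$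 (equivalently $\operatorname{cl}((A\setminus\{+\infty\})+C)$). For $A\subseteq Y$, $\operatorname{wMin}A=\{y\in A : (\{y\}-\operatorname{int}C)\cap A=\emptyset\}$. The infimal set is $\operatorname{Inf}A=\operatorname{wMin}\operatorname{Cl}_+A$ if $\emptyset\neq\operatorname{Cl}_+A\neq Y$; $\operatorname{Inf}A=\{-\infty\}$ if $\operatorname{Cl}_+A=Y$; $\operatorname{Inf}A=\{+\infty\}$ if $\operatorname{Cl}_+A=\emptyset$. For $A,B\subseteq\overline{Y}$, $A\preccurlyeq B$ means $\operatorname{Cl}_+A\supseteq\operatorname{Cl}_+B$. Domain and convexity. $\operatorname{dom}F=\{x\in X : F(x)\neq\{+\infty\}\}$ and $G(\operatorname{dom}F)=\bigcup_{x\in\operatorname{dom}F}G(x)$. $F$ is $C$-convex if $F(\lambda x_1+(1-\lambda)x_2)\preccurlyeq\lambda F(x_1)+(1-\lambda)F(x_2)$ for all $x_1,x_2\in X$, $\lambda\in(0,1)$. $G$ is $D$-convex if $\lambda G(x_1)+(1-\lambda)G(x_2)\subseteq G(\lambda x_1+(1-\lambda)x_2)+D$ for all $x_1,x_2\in X$, $\lambda\in(0,1)$. Problem (P) is the problem with value $\bar p=\operatorname{Inf}\bigcup_{x\in S}F(x)$, where $S=\{x\in X : G(x)\cap(-D)\neq\emptyset\}$. Perturbation map. For $(x,u)\in X\times U$ put $\varphi(x,u)=F(x)$ if $G(x)\cap(-D-u)\neq\emptyset$ and $\varphi(x,u)=\emptyset$ otherwise. Define $W:U\rightrightarrows\overline{Y}$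 by $W(u)=\operatorname{Inf}\bigcup_{x\in X}\varphi(x,u)$; thus $W(0)=\bar p$. Positive subgradient. For $(\bar u,\bar y)\in U\times Y$ with $\bar y\in W(\bar u)$, $\partial^+W(\bar u,\bar y)$ is the set of all $u^*\in-D^\circ$ such that $\bar y-\langle u^*,\bar u\rangle c\in\operatorname{Inf}\bigcup_{u\in U}(W(u)-\langle u^*,u\rangle c)$. Stability. (P) is called stable if $W(0)\neq\{+\infty\}$, $W(0)\neq\{-\infty\}$ and $\partial^+W(0,y)\neq\emptyset$ for all $y\in W(0)$.
   Formalization: The Slater condition is required at a point x of dom F with F(x) nonempty; as printed, with empty values allowed, the claim fails for F identically empty and G constantly {-d0}, d0 in int D, where W(0)={+∞}. *)

(* Defs.v *)
From HB Require Import structures.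
From mathcomp Require Import all_boot all_order all_algebra.
From mathcomp Require Import all_classical all_reals all_analysis.

Set Implicit Arguments.
Unset Strict Implicit.
Unset Printing Implicit Defensive.

Import Order.TTheory GRing.Theory Num.Theory.
Import numFieldNormedType.Exports.

Local Open Scope classical_set_scope.
Local Open Scope ring_scope.

(* The cone contains 0 as soon as it is nonempty. *)
Definition convex_cone (R : realType) (V : lmodType R) (A : set V) : Prop :=
  convex_set (A : set (convex_lmodType V)) /\
  (forall (t : R) (v : V), 0 <= t -> A v -> A (t *: v)).

Section ExtendedSets.
Context (R : realType) (Y : lmodType R).
Implicit Types A B : set (\bar Y).

(* [dual_adde] is the addition with (+oo) + (-oo) = +oo. *)
Definition eset_add A B : set (\bar Y) :=
  [set dual_adde a b | a in A & b in B].

(* Used for t > 0 only; [er_map] fixes +oo and -oo. *)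
Definition eset_scale (t : R) A : set (\bar Y) := er_map ( *:%R t) @` A.

End ExtendedSets.

Section InfimalSet.
Context (R : realType) (Y : topologicalLmodType R) (C : set Y).
Implicit Types A B : set (\bar Y).

Definition upper_closure A : set Y :=
  if `[< A (-oo)%E >] then setT
  else if `[< A = [set +oo%E] >] then set0
  else [set y | eset_add [set y%:E] (EFin @` interior C) `<=`
                eset_add (A `\ +oo%E) (EFin @` interior C)].

Definition wMin (A : set Y) : set Y :=
  [set y | A y /\ [set y - k | k in interior C] `&` A = set0].

Definition Inf A : set (\bar Y) :=
  if `[< upper_closure A = setT >] then [set (-oo)%E]
  else if `[< upper_closure A = set0 >] then [set +oo%E]
  else EFin @` wMin (upper_closure A).

Definition set_preceq A B : Prop := upper_closure B `<=` upper_closure A.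

End InfimalSet.

Section SetValuedMaps.
Context (R : realType) (X : lmodType R).

(* A point where F is empty belongs to dom F although it contributes nothing
   to an infimum. *)
Definition dom (Y : Type) (F : X -> set (\bar Y)) : set X :=
  [set x | F x <> [set +oo%E]].

Definition C_convex (Y : topologicalLmodType R) (C : set Y)
    (F : X -> set (\bar Y)) : Prop :=
  forall (x1 x2 : X) (l : R), 0 < l < 1 ->
    set_preceq C (F (l *: x1 + (1 - l) *: x2))
      (eset_add (eset_scale l (F x1)) (eset_scale (1 - l) (F x2))).

Definition D_convex (U : lmodType R) (D : set U) (G : X -> set U) : Prop :=
  forall (x1 x2 : X) (l : R), 0 < l < 1 ->
    [set l *: a + (1 - l) *: b | a in G x1 & b in G x2] `<=`
    [set a + d | a in G (l *: x1 + (1 - l) *: x2) & d in D].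

End SetValuedMaps.

Section Duality.
Context (R : realType) (U : tvsType R).

Definition top_dual : set (U -> R) :=
  [set f : U -> R | scalar f /\ continuous f].

Definition neg_polar (D : set U) : set (U -> R) :=
  [set f | top_dual f /\ forall d, D d -> f d <= 0].

End Duality.

Section Problem.
Context (R : realType) (X : lmodType R) (Y : topologicalLmodType R)
  (U : tvsType R) (C : set Y) (D : set U) (c : Y)
  (F : X -> set (\bar Y)) (G : X -> set U).

Definition feasible : set X := [set x | G x `&` (-%R @` D) !=set0].

Definition problem_value : set (\bar Y) := Inf C (\bigcup_(x in feasible) F x).

Definition perturbation (x : X) (u : U) : set (\bar Y) :=
  if `[< G x `&` [set - d - u | d in D] !=set0 >] then F x else set0.

Definition value_map (u : U) : set (\bar Y) :=
  Inf C (\bigcup_x perturbation x u).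

Definition pos_subdiff (W : U -> set (\bar Y)) (ubar : U) (ybar : Y) :
    set (U -> R) :=
  [set f | (-%R @` neg_polar D) f /\
    Inf C (\bigcup_u eset_add (W u) [set (- (f u *: c))%:E])
      (ybar - f ubar *: c)%:E].

Definition stable : Prop :=
  [/\ value_map 0 <> [set +oo%E], value_map 0 <> [set (-oo)%E] &
      forall y : Y, value_map 0 y%:E -> pos_subdiff value_map 0 y !=set0].

Lemma value_map0 : value_map 0 = problem_value.
Proof.
have E : [set - d - 0 | d in D] = -%R @` D.
  by apply: eq_imagel => d _; rewrite subr0.
rewrite /value_map /problem_value; congr Inf; apply/seteqP; split=> y /=.
  move=> [x _]; rewrite /perturbation E.
  by case: asboolP => // Sx Fxy; exists x.
move=> [x Sx Fxy]; exists x => //; rewrite /perturbation E.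
by case: asboolP => // nSx; case: (nSx Sx).
Qed.

End Problem.

(* Main.v *)
Require Import Defs.
From HB Require Import structures.
From mathcomp Require Import all_boot all_order all_algebra.
From mathcomp Require Import all_classical all_reals all_analysis.

Import Order.TTheory GRing.Theory Num.Theory.
Import numFieldNormedType.Exports.

Local Open Scope classical_set_scope.
Local Open Scope ring_scope.

(** The perturbed values are governed by the sets
    P(u) = { y | y exceeds, by an element of int C, some value of F at a point
    feasible for u }, called [strict_value u] below; they remember exactly
    what infimal sets see: a finite y belongs to Inf A precisely when y lies
    in the upper closure of A but not strictly above A ([mem_Inf_EFin]).
    Convexity of F and G makes the graph of P convex
    ([strict_value_convex]).

    Fix y in W(0) and restrict P to the line y + R c: let
    h(u) = inf { r | y + r c in P(u) }. Then h is convex, h(0) = 0 because y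
    is infimal, and Slater's condition bounds h above on a neighbourhood of 0
    ([strict_value_bounded]). A convex function with these properties has a
    continuous linear minorant f touching it at 0. Since P(u - d) contains
    P(u) for d in D, h(-d) <= 0, so f is nonnegative on D
    ([strict_value_subgradient]). Finally f <= h says that y + f(u) c is never
    strictly above the values at u, i.e. that y is not strictly above the
    union of the sets W(u) - f(u) c; as y belongs to that union it is in its
    infimal set ([mem_Inf_tilted]). Working along the single direction c
    replaces a separation of sets in U x Y by the scalar Hahn-Banach theorem.

    The Hahn-Banach theorem is obtained by applying Zorn's lemma to convex
    cones in U x R rather than to partially defined functionals: the lower
    boundary of a maximal cone is already linear
    ([epi_cone_linear_minorant]). *)

(** * Linear minorants of convex functions *)

Section LinearMinorant.
Set Implicit Arguments.
Unset Strict Implicit.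
Context {R : realType} {U : lmodType R}.

(** A cone of this kind lies above the graph of the sublinear function
    u |-> inf { r | K (u, r) }; the last clause keeps this infimum from being
    -oo as soon as the fibres over u and - u are inhabited. *)
Definition epi_cone (K : set (U * R)) : Prop :=
  [/\ forall u v r s, K (u, r) -> K (v, s) -> K (u + v, r + s),
      forall (t : R) u r, 0 < t -> K (u, r) -> K (t *: u, t * r) &
      forall r, K (0, r) -> 0 <= r].

Lemma maximal_epi_cone (K0 : set (U * R)) : epi_cone K0 -> K0 !=set0 ->
  exists2 K, epi_cone K /\ K0 `<=` K &
    forall K', epi_cone K' -> K `<=` K' -> K' `<=` K.
Proof.
move=> cK0 K0n0.
(* The chain may be empty, with empty union; hence the guard K !=set0. *)
pose P := [set K | epi_cone K /\ (K !=set0 -> K0 `<=` K)].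
have [|K [[cK K0K] maxK]] := @Zorn_bigcup _ P.
  move=> H HP totH; split; last first.
    move=> [x [K HK Kx]] y K0y; exists K => //.
    by apply: (HP _ HK).2 => //; exists x.
  split.
  - move=> u v r s [K1 H1 K1u] [K2 H2 K2v].
    have [K12|K21] := totH _ _ H1 H2.
      exists K2 => //; have [[addK _ _] _] := HP _ H2.
      by apply: addK => //; apply: K12.
    exists K1 => //; have [[addK _ _] _] := HP _ H1.
    by apply: addK => //; apply: K21.
  - move=> t u r t0 [K HK Ku]; exists K => //.
    by have [[_ scK _] _] := HP _ HK; apply: scK.
  - move=> r [K HK K0r]; have [[_ _ posK] _] := HP _ HK; exact: posK.
have Kn0 : K !=set0.
  apply/set0P/negP => /eqP K0E; apply: (maxK K0); last by split=> // _ x.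
  rewrite K0E; split; first exact: sub0set.
  by case: K0n0 => x K0x /(_ _ K0x).
exists K; first by split=> //; exact: K0K.
move=> K' cK' KK' x K'x; apply: contrapT => nKx.
apply: (maxK K').
  by split=> // /(_ _ K'x).
by split=> // _; apply: subset_trans KK'; exact: K0K.
Qed.

(** Hahn-Banach. The function f below a maximal cone K is sublinear. For each
    v, adding the ray through (- v, - f v) to K gives again such a cone, since
    f v bounds the fibre over v from below; by maximality the ray was already
    absorbed, which is superadditivity of f. *)
Lemma epi_cone_linear_minorant (K0 : set (U * R)) : epi_cone K0 ->
  (forall u, exists r, K0 (u, r)) ->
  exists2 f : U -> R, scalar f & forall u r, K0 (u, r) -> f u <= r.
Proof.
move=> cK0 totK0.
have [|K [[addK scK posK] K0K] maxK] := maximal_epi_cone cK0.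
  by have [r K0r] := totK0 0; exists (0, r).
have totK u : exists r, K (u, r) by have [r /K0K] := totK0 u; exists r.
pose f u := inf [set r | K (u, r)].
have f_le u r : K (u, r) -> f u <= r.
  move=> Kur; apply: ge_inf => //; have [s Ks] := totK (- u).
  exists (- s) => q /= Kq; rewrite -subr_ge0 opprK; apply: posK.
  by rewrite -(subrr u); apply: addK.
have f_ge u a : (forall r, K (u, r) -> a <= r) -> a <= f u.
  by move=> au; apply: lb_le_inf => //; exact: totK.
have fD_le u v : f (u + v) <= f u + f v.
  rewrite -lerBlDr; apply: (f_ge u) => r Kr; rewrite lerBlDl -lerBlDr.
  apply: (f_ge v) => s Ks; rewrite lerBlDr [s + r]addrC.
  by apply: f_le; apply: addK.
have fZ_le (t : R) u : 0 < t -> f (t *: u) <= t * f u.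
  move=> t0; rewrite mulrC -ler_pdivrMr //; apply: f_ge => r Kr.
  by rewrite ler_pdivrMr // mulrC; apply: f_le; apply: scK.
have fD_ge u v : f u + f v <= f (u + v).
  pose K' := [set x | exists t w r,
    [/\ 0 <= t, K (w, r) & x = (w - t *: v, r - t * f v)]].
  have cK' : epi_cone K'.
    split.
    - move=> _ _ _ _ [t [w [r [t0 Kw [-> ->]]]]]
        [t' [w' [r' [t0' Kw' [-> ->]]]]].
      exists (t + t'), (w + w'), (r + r').
      split; [exact: addr_ge0|exact: addK|].
      by congr pair; [rewrite scalerDl|rewrite mulrDl]; rewrite opprD addrACA.
    - move=> a _ _ a0 [t [w [r [t0 Kw [-> ->]]]]].
      exists (a * t), (a *: w), (a * r); split; [|exact: scK|].
        by rewrite mulr_ge0 // ltW.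
      by congr pair; [rewrite scalerBr scalerA|rewrite mulrBr mulrA].
    - move=> s [t [w [r [t0 Kw [/esym/eqP + ->]]]]].
      rewrite subr_eq0 => /eqP wE.
      rewrite subr_ge0; move: t0; rewrite le_eqVlt => /predU1P[t0|t0].
        by move: Kw; rewrite wE -t0 scale0r mul0r; exact: posK.
      rewrite mulrC -ler_pdivlMr //; apply: f_le.
      have /(scK t^-1) := Kw; rewrite invr_gt0 => /(_ t0).
      by rewrite wE scalerA mulVf ?gt_eqF // scale1r mulrC.
  have KK' : K `<=` K'.
    move=> [w r] Kw; exists 0, w, r; split=> //.
    by rewrite scale0r mul0r !subr0.
  apply: (f_ge (u + v)) => r Kr; rewrite -lerBrDr; apply: f_le.
  apply: (maxK K') => //; exists 1, (u + v), r; split=> //.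
  by rewrite scale1r mul1r addrK.
have fD u v : f (u + v) = f u + f v by apply/le_anti; rewrite fD_le fD_ge.
have f0 : f 0 = 0 by apply: (addrI (f 0)); rewrite -fD !addr0.
have fN u : f (- u) = - f u by apply/eqP; rewrite -addr_eq0 -fD addNr f0 eqxx.
have fZ_gt0 (t : R) u : 0 < t -> f (t *: u) = t * f u.
  move=> t0; apply/le_anti; rewrite fZ_le //=.
  by rewrite -lerN2 -mulrN -!fN -scalerN fZ_le.
exists f; last by move=> u r /K0K; exact: f_le.
move=> a u v; rewrite fD; congr (_ + _).
have [a0|a0|->] := ltgtP a 0; [|exact: fZ_gt0|by rewrite scale0r mul0r f0].
by rewrite -[a]opprK scaleNr fN fZ_gt0 ?oppr_gt0 // !mulNr.
Qed.

(** Linear minorant of a convex function, given by its epigraph Q so that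
    infinite values need no special treatment. The cone spanned by Q is the
    epigraph of the directional derivative at 0, which is finite because Q
    reaches a point in every direction and stays nonnegative over 0. *)
Lemma convex_linear_minorant (Q : U -> R -> Prop) :
  (forall l u v r s, 0 < l < 1 -> Q u r -> Q v s ->
     Q (l *: u + (1 - l) *: v) (l * r + (1 - l) * s)) ->
  (forall u, exists t r, 0 < t /\ Q (t *: u) r) ->
  (forall r, Q 0 r -> 0 <= r) ->
  exists2 f : U -> R, scalar f & forall u r, Q u r -> f u <= r.
Proof.
move=> cvxQ absQ posQ.
pose K := [set x | exists2 t, 0 < t & Q (t *: x.1) (t * x.2)].
have cK : epi_cone K.
  split.
  - move=> u v r s [t1 /= t1_gt0 Q1] [t2 /= t2_gt0 Q2].
    (* The weights t2 / (t1 + t2) and t1 / (t1 + t2) bring both points to the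
       common scale t1 * t2 / (t1 + t2). *)
    have t12 : 0 < t1 + t2 by exact: addr_gt0.
    have E : 1 - t2 / (t1 + t2) = t1 / (t1 + t2).
      by rewrite -{1}(divff (lt0r_neq0 t12)) -mulrBl addrK.
    exists (t1 * t2 / (t1 + t2)); first by rewrite divr_gt0 // mulr_gt0.
    have := @cvxQ (t2 / (t1 + t2)) _ _ _ _ _ Q1 Q2.
    rewrite E !scalerA !mulrA.
    rewrite (_ : t2 / (t1 + t2) * t1 = t1 * t2 / (t1 + t2)); last first.
      by rewrite mulrAC [t2 * t1]mulrC.
    rewrite (_ : t1 / (t1 + t2) * t2 = t1 * t2 / (t1 + t2)); last first.
      by rewrite mulrAC.
    rewrite -scalerDr -mulrDr; apply.
    by rewrite divr_gt0 //= ltr_pdivrMr // mul1r ltrDr.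
  - move=> a u r a0 [t /= t0 Qt]; exists (t / a); first exact: divr_gt0.
    by rewrite /= scalerA mulrA divfK ?gt_eqF.
  - by move=> r [t /= t0]; rewrite scaler0 => /posQ; rewrite pmulr_rge0.
have [|f lf fle] := epi_cone_linear_minorant cK.
  move=> u; have [t [r [t0 Qt]]] := absQ u; exists (r / t), t => //=.
  by rewrite mulrCA divff ?gt_eqF // mulr1.
exists f => // u r Qu; apply: fle; exists 1 => //=.
by rewrite scale1r mul1r.
Qed.

End LinearMinorant.

(** * Topological modules *)

Section TopologicalModule.
Set Implicit Arguments.
Unset Strict Implicit.
Context {R : realType} {V : topologicalLmodType R}.

Lemma near_homothety (A : set V) (k : R) (v z : V) :
  nbhs (k *: (v - z)) A -> \forall w \near v, A (k *: (w - z)).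
Proof.
have : k *: (w - z) @[w --> v] --> k *: (v - z).
  apply: (@continuous2_cvg _ _ _ _ _ _ (fun=> k : R^o) (fun w => w - z)
    (fun (a : R^o) w => a *: w)).
  - exact: (@scale_continuous _ V (k, v - z)).
  - exact: cvg_cst.
  - apply: (@continuous2_cvg _ _ _ _ _ _ id (fun=> - z) +%R).
    + exact: (@add_continuous V (v, - z)).
    + exact: cvg_id.
    + exact: cvg_cst.
exact.
Qed.

Lemma near_line (A : set V) (v z : V) :
  nbhs v A -> \forall t \near (0 : R), A (v + t *: z).
Proof.
have : v + t *: z @[t --> (0 : R)] --> v + 0 *: z.
  apply: (@continuous2_cvg _ _ _ _ _ _ (fun=> v) (fun t : R => t *: z) +%R).
  - exact: (@add_continuous V (v, 0 *: z)).
  - exact: cvg_cst.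
  - apply: (@continuous2_cvg _ _ _ _ _ _ (id : R -> R^o) (fun=> z)
      (fun (a : R^o) w => a *: w)).
    + exact: (@scale_continuous _ V (0, z)).
    + exact: cvg_id.
    + exact: cvg_cst.
by rewrite scale0r addr0; exact.
Qed.

Lemma line_absorbed (A : set V) (v z : V) :
  nbhs v A -> exists2 t : R, 0 < t & A (v + t *: z).
Proof.
move=> /near_line - /(_ z) /nbhs_ballP[e /= e0 Ae].
exists (e / 2); first exact: divr_gt0.
apply: Ae; rewrite /ball /= sub0r normrN gtr0_norm ?divr_gt0 //.
by rewrite ltr_pdivrMr // ltr_pMr // ltr1n.
Qed.

Lemma scalar_map0 (f : V -> R) : scalar f -> f 0 = 0.
Proof.
by move=> lf; rewrite -[X in f X](addNr 0) -scaleN1r lf mulN1r addNr.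
Qed.

Lemma scalar_mapB (f : V -> R) k w z :
  scalar f -> f (k *: (w - z)) = k * (f w - f z).
Proof.
move=> lf; rewrite -[k *: _]addr0 lf scalar_map0 // addr0.
by rewrite addrC -scaleN1r lf mulN1r addrC.
Qed.

(** A one-sided bound M on a neighbourhood A of 0 suffices: apply it to both
    k *: (w - v) and its opposite for w close to v. *)
Lemma scalar_continuous (f : V -> R) (A : set V) (M : R) : scalar f ->
  nbhs 0 A -> (forall v, A v -> f v <= M) -> continuous f.
Proof.
move=> lf A0 fM v.
have M0 : 0 <= M.
  by apply: le_trans (fM _ (nbhs_singleton A0)); rewrite scalar_map0.
have M1 : 0 < M + 1 by rewrite ltr_wpDl.
(* M + 1 in place of M makes the final estimate strict and k positive. *)
apply/cvgrPdist_lt => e e0; pose k := (M + 1) / e.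
have k0 : 0 < k by exact: divr_gt0.
have Ak : nbhs (k *: (v - v)) A by rewrite subrr scaler0.
have ANk : nbhs (- k *: (v - v)) A by rewrite subrr scaler0.
have := near_homothety Ak; have := near_homothety ANk.
apply: filterS2 => w /fM + /fM.
rewrite !scalar_mapB // mulNr -mulrN opprB => le1 le2.
have h x : k * x <= M -> x < e.
  rewrite -ler_pdivlMl // => /le_lt_trans; apply.
  by rewrite invf_div mulrAC ltr_pdivrMr // ltr_pM2l // ltrDl.
by rewrite ltr_norml ltrNl opprB !h.
Qed.

End TopologicalModule.

(** * Interiors of convex cones *)

Section ConeInterior.
Set Implicit Arguments.
Unset Strict Implicit.
Context {R : realType} {Y : topologicalLmodType R} {C : set Y}.
Hypothesis C_cone : convex_cone C.

Lemma cone_add a b : C a -> C b -> C (a + b).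
Proof.
move=> Ca Cb; have [cvxC scaleC] := C_cone.
have h0 : 0 <= 2^-1 :> R by rewrite invr_ge0.
have h1 : 2^-1 <= 1 :> R by rewrite invf_le1 ?ler1n.
have := cvxC a b (Itv01 h0 h1); rewrite !inE => /(_ Ca Cb).
move=> /(scaleC 2) - /(_ (ler0n _ _)).
rewrite /conv /= /unstable.onem scalerDr !scalerA mulrBr mulr1.
by rewrite mulfV ?pnatr_eq0 // (natrD _ 1 1) addrK !scale1r.
Qed.

(** The translate by b of a neighbourhood of a inside C stays inside C. *)
Lemma interior_cone_addr a b : interior C a -> C b -> interior C (a + b).
Proof.
move=> Ca Cb.
have : nbhs (1 *: (a + b - b)) C by rewrite scale1r addrK.
move=> /near_homothety; apply: filterS => w; rewrite scale1r => Cw.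
by rewrite -(subrK b w); apply: cone_add.
Qed.

Lemma interior_cone_add a b :
  interior C a -> interior C b -> interior C (a + b).
Proof. by move=> Ca /interior_subset; exact: interior_cone_addr. Qed.

Lemma interior_cone_scale (t : R) a :
  0 < t -> interior C a -> interior C (t *: a).
Proof.
move=> t0 Ca.
have : nbhs (t^-1 *: (t *: a - 0)) C.
  by rewrite subr0 scalerA mulVf ?gt_eqF // scale1r.
move=> /near_homothety; apply: filterS => w; rewrite subr0.
move=> /(C_cone.2 t) - /(_ (ltW t0)).
by rewrite scalerA mulfV ?gt_eqF // scale1r.
Qed.

Lemma interior_cone_shrink k c : interior C k ->
  exists2 e : R, 0 < e & interior C (k - e *: c).
Proof.
move=> /nbhs_interior - /(line_absorbed (- c))[e e0 Ce].
by exists e => //; rewrite -scalerN.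
Qed.

(** An interior direction is an order unit: c + t^-1 *: y is still interior
    for t large, and cones may be rescaled by t. *)
Lemma interior_cone_absorb y c : interior C c ->
  exists2 t : R, 0 < t & interior C (y + t *: c).
Proof.
move=> /nbhs_interior - /(line_absorbed y)[e e0 Ce].
exists e^-1; first by rewrite invr_gt0.
have := @interior_cone_scale e^-1 _ _ Ce; rewrite invr_gt0 => /(_ e0).
by rewrite scalerDr scalerA mulVf ?gt_eqF // scale1r addrC.
Qed.

End ConeInterior.

(** * Upper closures and infimal sets *)

Section StrictUpper.
Set Implicit Arguments.
Unset Strict Implicit.
Context {R : realType} {Y : topologicalLmodType R} (C : set Y) {c : Y}.
Hypotheses (C_cone : convex_cone C) (c_int : interior C c).
Implicit Types (A B : set (\bar Y)) (y k : Y).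

(** The open counterpart of the upper closure: A + int C, where -oo lies
    strictly below every point and +oo contributes nothing. *)
Definition strict_upper A : set Y :=
  [set y | A (-oo)%E \/ exists2 a, A a%:E & interior C (y - a)].

(** This absorbs the three-way case distinction defining the upper closure;
    c in int C makes the right-hand side fail for A = {+oo}, as it should. *)
Lemma upper_closureP A y :
  upper_closure C A y <-> forall k, interior C k -> strict_upper A (y + k).
Proof.
rewrite /upper_closure; case: asboolP => [AN|AN].
  by split=> // _ k _; left.
case: asboolP => [->|_]; first by split=> // /(_ c c_int)[|[a]].
split=> [sub k Ck|up _ [_ -> [_ [k Ck <-] <-]]].
- have [|[a| |] [Aa nAa]] := sub (y + k)%:E.
  + by exists y%:E => //; exists k%:E => //; exists k.
  + move=> [_ [k' Ck' <-] [E]]; right; exists a => //.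
    by rewrite -E addrAC subrr add0r.
  + by case=> _ [k' _ <-].
  + by case=> _ [k' _ <-].
- have [//|[a Aa Cka]] := up _ Ck.
  exists a%:E; first by split.
  exists (y + k - a)%:E; first by exists (y + k - a).
  by rewrite /dual_adde /= addrC subrK.
Qed.

Lemma strict_upperD A y k :
  strict_upper A y -> interior C k -> strict_upper A (y + k).
Proof.
move=> [AN|[a Aa Ca]] Ck; [by left|right; exists a => //].
by rewrite addrAC; exact: interior_cone_add.
Qed.

Lemma strict_upper_shrink A y : strict_upper A y ->
  exists2 e : R, 0 < e & strict_upper A (y - e *: c).
Proof.
move=> [AN|[a Aa]]; first by exists 1 => //; left.
move=> /(@interior_cone_shrink _ _ _ _ c)[e e0 Ce].
by exists e => //; right; exists a; rewrite // addrAC.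
Qed.

Lemma strict_upper_closure A : strict_upper A `<=` upper_closure C A.
Proof. by move=> y Ay; apply/upper_closureP => k; exact: strict_upperD. Qed.

Lemma strict_upper_nonempty A : A <> [set +oo%E] -> A !=set0 ->
  strict_upper A !=set0.
Proof.
move=> Apoo [[a Aa|Ap|AN]].
- by exists (a + c); right; exists a; rewrite // addrC addKr.
- apply: contrapT => A0; apply: Apoo; apply/seteqP; split=> [[a| |] //|_ -> //].
  + move=> Aa; exfalso; apply: A0; exists (a + c); right.
    by exists a; rewrite // addrC addKr.
  + by move=> AN; exfalso; apply: A0; exists 0; left.
- by exists 0; left.
Qed.

(** The preorder compares upper closures, but passing to strict upper sets
    loses nothing: a strict point can be lowered a little along c, compared in
    the closure, and raised again. *)
Lemma strict_upper_preceq A B :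
  set_preceq C A B -> strict_upper B `<=` strict_upper A.
Proof.
move=> AB y /strict_upper_shrink[e e0 /strict_upper_closure/AB/upper_closureP].
by move=> /(_ (e *: c)); rewrite subrK; apply; exact: interior_cone_scale.
Qed.

(** A weakly minimal point of the upper closure is one that cannot be lowered
    along int C, that is, one not strictly above A. *)
Lemma mem_Inf_EFin A y :
  Inf C A y%:E <-> upper_closure C A y /\ ~ strict_upper A y.
Proof.
split=> [|[Ay nAy]]; rewrite /Inf.
  case: asboolP => // _; case: asboolP => // _ [y' [Ay minAy] [y'y]].
  rewrite {}y'y in Ay minAy.
  split=> // /strict_upper_shrink[e e0 /strict_upper_closure Aye].
  suff : set0 (y - e *: c) by [].
  rewrite -minAy; split=> //=; exists (e *: c) => //.
  exact: interior_cone_scale.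
have nAk k : interior C k -> ~ upper_closure C A (y - k).
  by move=> Ck /upper_closureP/(_ k Ck); rewrite subrK.
case: asboolP => [AT|_]; first by case: (nAk c c_int); rewrite AT.
case: asboolP => [A0|_]; first by move: Ay; rewrite A0.
exists y => //; split=> //; apply/seteqP; split=> // z [[k Ck zE]]; rewrite -zE.
exact: nAk.
Qed.

Lemma Inf_ninfty A : Inf C A (-oo)%E -> upper_closure C A = setT.
Proof. by rewrite /Inf; case: asboolP => // _; case: asboolP => // _ []. Qed.

Lemma Inf_pinfty A : Inf C A (+oo)%E -> upper_closure C A = set0.
Proof. by rewrite /Inf; case: asboolP => // _; case: asboolP => // _ []. Qed.

Lemma strict_upper_Inf A : strict_upper (Inf C A) `<=` strict_upper A.
Proof.
move=> y [/Inf_ninfty AT|[a /mem_Inf_EFin[/upper_closureP Aa _] Ca]].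
  have : upper_closure C A (y - c) by rewrite AT.
  by move=> /upper_closureP/(_ c c_int); rewrite subrK.
by have := Aa _ Ca; rewrite addrC subrK.
Qed.

Lemma strict_upper_eset_conv A B (l : R) y1 y2 : 0 < l < 1 ->
  strict_upper A y1 -> strict_upper B y2 ->
  strict_upper (eset_add (eset_scale l A) (eset_scale (1 - l) B))
    (l *: y1 + (1 - l) *: y2).
Proof.
move=> /andP[l0 l1]; have l1' : 0 < 1 - l by rewrite subr_gt0.
have S t X x : X x -> eset_scale t X (er_map ( *:%R t) x).
  by move=> Xx; exists x.
move=> [AN|[a Aa Ca]] [BN|[b Bb Cb]].
- by left; exists (-oo)%E; [exact: S AN|exists (-oo)%E; [exact: S BN|]].
- left; exists (-oo)%E; first exact: S AN.
  by exists ((1 - l) *: b)%:E; [exact: S Bb|].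
- by left; exists (l *: a)%:E; [exact: S Aa|exists (-oo)%E; [exact: S BN|]].
- right; exists (l *: a + (1 - l) *: b).
    exists (l *: a)%:E; first exact: S Aa.
    by exists ((1 - l) *: b)%:E; [exact: S Bb|].
  rewrite opprD addrACA -!scalerBr.
  by apply: interior_cone_add => //; exact: interior_cone_scale.
Qed.

End StrictUpper.

(** * The perturbed value map and its subgradients *)

Section ValueMap.
Set Implicit Arguments.
Unset Strict Implicit.
Context {R : realType} {X : lmodType R} {Y : topologicalLmodType R}
  {U : tvsType R} {C : set Y} {D : set U} {c : Y}
  {F : X -> set (\bar Y)} {G : X -> set U}.
Hypotheses (C_cone : convex_cone C) (D_cone : convex_cone D).
Hypothesis c_int : interior C c.
Hypotheses (F_convex : C_convex C F) (G_convex : D_convex D G).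

Definition strict_value (u : U) : set Y :=
  strict_upper C (\bigcup_x perturbation D F G x u).

Lemma strict_valueP u y : strict_value u y <->
  exists x d, [/\ D d, G x (- d - u) & strict_upper C (F x) y].
Proof.
have pertP x a : perturbation D F G x u a <->
    exists2 d, D d & G x (- d - u) /\ F x a.
  rewrite /perturbation; case: asboolP => [[v [Gx [d Dd vE]]]|nGx]; split=> //.
  - by move=> Fa; exists d; rewrite // vE.
  - by case=> ? _ [].
  - by case=> d Dd [Gx Fa]; case: nGx; exists (- d - u); split=> //; exists d.
split.
- case=> [[x _ /pertP[d Dd [Gx Fx]]]|[a [x _ /pertP[d Dd [Gx Fx]]] Ca]];
    exists x, d; split=> //; first by left.
  by right; exists a.
- move=> [x [d [Dd Gx [FN|[a Fa Ca]]]]].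
    by left; exists x => //; apply/pertP; exists d.
  by right; exists a => //; exists x => //; apply/pertP; exists d.
Qed.

(** Joint convexity of the graph of [strict_value]: D-convexity of G combines
    feasible points of two perturbations, C-convexity of F compares the
    values there. *)
Lemma strict_value_convex (l : R) u v y z : 0 < l < 1 ->
  strict_value u y -> strict_value v z ->
  strict_value (l *: u + (1 - l) *: v) (l *: y + (1 - l) *: z).
Proof.
move=> l01 /strict_valueP[x1 [d1 [D1 G1 F1]]].
move=> /strict_valueP[x2 [d2 [D2 G2 F2]]].
have [|g Gg [d Dd gdE]] := G_convex l01 (_ : [set l *: a + (1 - l) *: b |
    a in G x1 & b in G x2] (l *: (- d1 - u) + (1 - l) *: (- d2 - v))).
  by exists (- d1 - u) => //; exists (- d2 - v).
have /andP[l0 l1] := l01.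
apply/strict_valueP; exists (l *: x1 + (1 - l) *: x2).
exists (l *: d1 + (1 - l) *: d2 + d); split.
- apply: cone_add => //; apply: cone_add => //; apply: D_cone.2 => //.
    exact: ltW.
  by rewrite subr_ge0 ltW.
- suff -> : - (l *: d1 + (1 - l) *: d2 + d) - (l *: u + (1 - l) *: v) = g by [].
  rewrite -[RHS](addrK d) gdE !scalerBr !scalerN [in RHS]addrACA.
  by rewrite !opprD [LHS]addrAC.
- apply: (strict_upper_preceq C_cone c_int (F_convex l01)).
  exact: strict_upper_eset_conv.
Qed.

(** Enlarging the right-hand side of the constraint by D enlarges the feasible
    set. *)
Lemma strict_value_cone u d y :
  D d -> strict_value u y -> strict_value (u - d) y.
Proof.
move=> Dd /strict_valueP[x [d' [Dd' Gx Fy]]]; apply/strict_valueP.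
exists x, (d' + d); split=> //; first exact: cone_add.
by rewrite (_ : _ - _ = - d' - u) // opprB opprD addrA subrK.
Qed.

(** At a Slater point G meets - D - u for all small u, so one strict upper
    value of F there serves a whole neighbourhood; c being an order unit, it
    can be taken on the line y + R c. *)
Lemma strict_value_bounded y :
  (\bigcup_(x in dom F `&` [set x | F x !=set0]) G x)
    `&` (-%R @` interior D) !=set0 ->
  exists M, \forall u \near 0, strict_value u (y + M *: c).
Proof.
move=> [g0 [[x0 [Fx0 Fx0n0] Gx0] [d0 Dd0 d0E]]]; rewrite -d0E in Gx0.
have [y0 Fy0] := strict_upper_nonempty c_int Fx0 Fx0n0.
have [M M0 Cy] := interior_cone_absorb C_cone (y - y0) c_int.
exists M.
have : nbhs (- 1 *: (0 - d0)) D by rewrite sub0r scaleN1r opprK.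
move=> /near_homothety; apply: filterS => u; rewrite scaleN1r opprB => Du.
apply/strict_valueP; exists x0, (d0 - u); split=> //.
  by rewrite opprB addrAC subrr add0r.
have := strict_upperD C_cone Fy0 Cy.
by rewrite addrA addrCA subrr addr0.
Qed.

(** A subgradient at 0 of h(u) = inf { r | y + r c in strict_value u }. The
    hypotheses say that h is bounded above near 0 and that h(0) = 0. *)
Lemma strict_value_subgradient y M :
  (\forall u \near 0, strict_value u (y + M *: c)) ->
  (forall e : R, 0 < e -> strict_value 0 (y + e *: c)) ->
  ~ strict_value 0 y ->
  exists f : U -> R, [/\ top_dual f, forall d, D d -> 0 <= f d &
    forall u r, strict_value u (y + r *: c) -> f u <= r].
Proof.
move=> bndM up0 nup0.
have [||r|f lf f_le] :=
    @convex_linear_minorant R U (fun u r => strict_value u (y + r *: c)).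
- move=> l u v r s l01 Qu Qv; have := strict_value_convex l01 Qu Qv.
  by rewrite !scalerDr addrACA -scalerDl subrKC scale1r !scalerA -scalerDl.
- move=> u; have [t t0] := line_absorbed u bndM.
  by rewrite add0r => Qt; exists t, M.
- move=> Qr; rewrite leNgt; apply/negP => r0; apply: nup0.
  have := strict_upperD C_cone Qr (interior_cone_scale C_cone _ c_int).
  by move=> /(_ (- r)); rewrite oppr_gt0 scaleNr addrK; exact.
exists f; split=> //.
- split=> //; apply: (scalar_continuous lf bndM) => u; exact: f_le.
- move=> d Dd; have fN : f (- d) = - f d.
    by rewrite -[- d]addr0 -scaleN1r lf scalar_map0 // addr0 mulN1r.
  rewrite -oppr_le0 -fN; apply/ler_addgt0Pr => e e0; rewrite add0r.
  by apply: f_le; rewrite -sub0r; apply: strict_value_cone => //; exact: up0.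
Qed.

(** If y were strictly above the tilted union, then y + f u *: c would be
    strictly above the values at some u, hence so would y + (f u - e) *: c for
    some e > 0, against the lower bound f u. *)
Lemma mem_Inf_tilted (f : U -> R) y : f 0 = 0 ->
  value_map C D F G 0 y%:E ->
  (forall u r, strict_value u (y + r *: c) -> f u <= r) ->
  Inf C (\bigcup_u eset_add (value_map C D F G u) [set (- (f u *: c))%:E]) y%:E.
Proof.
move=> f0 W0y f_le; set B := \bigcup_u _.
have By : B y%:E.
  exists 0 => //; exists y%:E => //; exists (- (f 0 *: c))%:E => //.
  by rewrite f0 scale0r oppr0 /dual_adde /= addr0.
apply/(mem_Inf_EFin C_cone c_int); split.
  apply/(upper_closureP c_int) => k Ck; right; exists y => //.
  by rewrite addrAC subrr add0r.
have upB z : strict_upper C B z -> exists u, strict_value u (z + f u *: c).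
  move=> upz; suff [u upu] : exists u,
      strict_upper C (value_map C D F G u) (z + f u *: c).
    by exists u; apply: (strict_upper_Inf C_cone c_int).
  case: upz => [[u _ [[w| |] Ww [_ -> //]]]|]; first by exists u; left.
  move=> [b [u _ [[w| |] Ww [_ -> // [bE]]]] Cb].
  exists u; right; exists w => //.
  by move: Cb; rewrite -bE opprB addrA.
move=> /upB[u /(@strict_upper_shrink _ _ _ c)[e e0]].
rewrite -addrA -scalerBl => /f_le; rewrite lerDl oppr_ge0.
by rewrite leNgt e0.
Qed.

End ValueMap.

Theorem theorem3p8 (R : realType) (X : lmodType R)
    (Y : topologicalLmodType R) (U : tvsType R)
    (C : set Y) (D : set U) (c : Y)
    (F : X -> set (\bar Y)) (G : X -> set U)
    (C_cone : convex_cone C) (C_int : interior C !=set0) (C_intT : interior C <> setT)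
    (U_sep : hausdorff_space U)
    (D_cone : convex_cone D) (D_closed : closed D) (D_proper : D <> setT)
    (D_int : interior D !=set0)
    (c_int : interior C c)
    (F_convex : C_convex C F) (G_convex : D_convex D G)
    (slater : (\bigcup_(x in dom F `&` [set x | F x !=set0]) G x)
                `&` (-%R @` interior D) !=set0)
    (W0 : value_map C D F G 0 <> [set (-oo)%E]) :
  stable C D c F G.
Proof.
split=> //.
- move=> W0p; have /Inf_pinfty E : value_map C D F G 0 +oo%E by rewrite W0p.
  have [M /nbhs_singleton] := strict_value_bounded C_cone c_int 0 slater.
  by move=> /(strict_upper_closure C_cone c_int); rewrite E.
- move=> y W0y.
  have /(mem_Inf_EFin C_cone c_int)[/(upper_closureP c_int) cly nupy] := W0y.
  have [M bndM] := strict_value_bounded C_cone c_int y slater.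
  have [|f [[lf cf] f_ge0 f_le]] := strict_value_subgradient
    C_cone D_cone c_int F_convex G_convex bndM _ nupy.
    by move=> e e0; apply: cly; exact: interior_cone_scale.
  have f0 := scalar_map0 lf.
  exists f; split; last first.
    by rewrite f0 scale0r subr0; exact: mem_Inf_tilted.
  exists (- f); last by rewrite opprK.
  split; last by move=> d Dd; rewrite oppr_le0; exact: f_ge0.
  split; first by move=> a u v /=; rewrite !fctE lf opprD mulrN.
  by move=> u; apply: cvgN; exact: cf.
Qed.
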